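(* Let $r, m, N$ be positive integers. If \[ N \ge \prod_{k=1}^r \left(1 + 2 k^{1/m}\right) \] and $\{1, \dots, N\}$ is colored using $r$ colors, then there exists a monochromatic solution to the equation \[ x_1+\cdots+x_{m+1}=y_1+\cdots+y_m . \]
   Context: A coloring of $\{1,\dots,N\}$ using $r$ colors is a function $\phi:\{1,\dots,N\}\to\{1,\dots,r\}$. A monochromatic solution to the equation is a choice of $x_1,\dots,x_{m+1},y_1,\dots,y_m\in\{1,\dots,N\}$ satisfying it, all having the same color under $\phi$; the variables in a solution are allowed to repeat (they need not be distinct). *)

(* Defs.v *)
From mathcomp Require Import all_boot.

Set Implicit Arguments.
Unset Strict Implicit.
Unset Printing Implicit Defensive.

(* The values of [phi] outside {1, ..., N} are irrelevant. *)
Definition is_coloring (N r : nat) (phi : nat -> nat) : Prop :=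
  forall n : nat, 1 <= n <= N -> 1 <= phi n <= r.

Definition is_solution (m : nat) (x : 'I_m.+1 -> nat) (y : 'I_m -> nat) : Prop :=
  \sum_(i < m.+1) x i = \sum_(j < m) y j.

Definition has_monochromatic_solution (m N : nat) (phi : nat -> nat) : Prop :=
  exists (x : 'I_m.+1 -> nat) (y : 'I_m -> nat) (c : nat),
    [/\ forall i : 'I_m.+1, 1 <= x i <= N /\ phi (x i) = c,
        forall j : 'I_m, 1 <= y j <= N /\ phi (y j) = c
      & is_solution x y].

(* Main.v *)
(** Join two elements of [{0, ..., N}] by an edge coloured by their difference.
    Every vertex [v] keeps the set [T v] of colours its edges may still have,
    and weighs [1 / P_|T v|], where [P_k] is the product of the first [k]
    factors.  Let [v] be a vertex with [k = |T v| > 0] minimal, and [j] a colour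
    carrying at least a fraction [1 / k] of the weight around [v].  Starting
    from [{v}], replace [Y] by the heavier of its upper and lower
    [j]-neighbourhoods.  For [m] steps these layers span no edge of colour [j],
    as such an edge would give a monochromatic solution, and they cannot always
    grow by a factor [k^(1/m)]; so some layer [Y] has a [j]-neighbourhood of
    weight at most [2 k^(1/m)] times its own.  Deleting that neighbourhood and
    removing [j] from [T] on [Y] does not decrease the total weight, because
    [k] is minimal: each vertex of [Y] gains a factor at least
    [1 + 2 k^(1/m)].  When no colour is left the graph has total weight at most 1, whereas the initial
    weight is [(N + 1) / P_r > 1]. *)

Require Import Defs.
From mathcomp Require Import all_boot all_order all_algebra.
From mathcomp Require Import lra.
From mathcomp Require boolp.
From mathcomp Require Import reals exp.

Set Implicit Arguments.
Unset Strict Implicit.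
Unset Printing Implicit Defensive.

Import Order.TTheory GRing.Theory Num.Theory.
Local Open Scope ring_scope.

(** * Partial products of the bound *)

Definition bound_prod (R : realType) (m k : nat) : R :=
  \prod_(1 <= i < k.+1) (1 + 2 * (i%:R : R) `^ (m%:R)^-1).

Lemma bound_prodS (R : realType) (m k : nat) :
  bound_prod R m k.+1 = bound_prod R m k * (1 + 2 * (k.+1%:R : R) `^ (m%:R)^-1).
Proof. by rewrite /bound_prod big_nat_recr. Qed.

Lemma bound_prod_gt0 (R : realType) (m k : nat) : 0 < bound_prod R m k.
Proof.
rewrite /bound_prod; apply: prodr_gt0 => i _.
by rewrite ltr_pwDl // mulr_ge0 // powR_ge0.
Qed.

(** * The difference graph and its coloured neighbourhoods *)

Section DifferenceGraph.
Variables (N m : nat) (C : finType) (chi : nat -> C).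

Implicit Types (V Y : {set 'I_N.+1}) (j : C).

Definition colored j : pred nat := fun a => (0 < a <= N)%N && (chi a == j).

Definition upper j V Y :=
  [set w in V | [exists y in Y, ((y : nat) < w)%N && (chi (w - y) == j)]].
Definition lower j V Y :=
  [set w in V | [exists y in Y, ((w : nat) < y)%N && (chi (y - w) == j)]].
Definition nbr j V Y := upper j V Y :|: lower j V Y.

Lemma upperP j V Y (w : 'I_N.+1) :
  reflect (w \in V /\ exists2 y : 'I_N.+1, y \in Y &
             exists2 a, colored j a & (w = y + a :> nat)%N)
          (w \in upper j V Y).
Proof.
rewrite inE; apply: (iffP andP) => -[wV H]; split=> //.
  have [y /and3P[yY yw cj]] := existsP H.
  exists y => //; exists (w - y)%N; last by rewrite subnKC // ltnW.
  by rewrite /colored subn_gt0 yw cj (leq_trans (leq_subr _ _)) // -ltnS.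
case: H => y yY [a /andP[/andP[a0 _] cj] E]; apply/existsP; exists y.
by rewrite yY E addKn cj -[X in (X < _)%N]addn0 ltn_add2l a0.
Qed.

Lemma lowerP j V Y (w : 'I_N.+1) :
  reflect (w \in V /\ exists2 y : 'I_N.+1, y \in Y &
             exists2 a, colored j a & (y = w + a :> nat)%N)
          (w \in lower j V Y).
Proof.
rewrite inE; apply: (iffP andP) => -[wV H]; split=> //.
  have [y /and3P[yY yw cj]] := existsP H.
  exists y => //; exists (y - w)%N; last by rewrite subnKC // ltnW.
  by rewrite /colored subn_gt0 yw cj (leq_trans (leq_subr _ _)) // -ltnS.
case: H => y yY [a /andP[/andP[a0 _] cj] E]; apply/existsP; exists y.
by rewrite yY E addKn cj -[X in (X < _)%N]addn0 ltn_add2l a0.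
Qed.

(** Subtraction is truncated, so one summand vanishes and the argument of [chi] is the distance
    between [u] and [w]. *)
Definition diff_color (u w : nat) : C := chi ((u - w) + (w - u))%N.

Lemma nbrP j V Y (w : 'I_N.+1) :
  reflect (w \in V /\ exists2 y : 'I_N.+1, y \in Y &
             (y != w) && (diff_color w y == j))
          (w \in nbr j V Y).
Proof.
rewrite !inE -andb_orr; apply: (iffP andP) => -[wV H]; split=> //.
  case/orP: H => /existsP[y /and3P[yY yw cj]]; exists y => //.
    rewrite -val_eqE (ltn_eqF yw) /diff_color.
    by rewrite (eqP (ltnW yw : _ - _ == 0)%N) addn0.
  rewrite eq_sym -val_eqE (ltn_eqF yw) /diff_color.
  by rewrite (eqP (ltnW yw : _ - _ == 0)%N).
case: H => y yY /andP[nyw]; rewrite /diff_color.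
move: nyw; rewrite -val_eqE neq_ltn => /orP[yw|yw].
  rewrite (eqP (ltnW yw : _ - _ == 0)%N) addn0 => cj.
  by apply/orP; left; apply/existsP; exists y; rewrite yY yw.
rewrite (eqP (ltnW yw : _ - _ == 0)%N) add0n => cj.
by apply/orP; right; apply/existsP; exists y; rewrite yY yw.
Qed.

Lemma nbr_sub j V Y : nbr j V Y \subset V.
Proof. by apply/subsetP => w /nbrP[]. Qed.

(** Invariant of the layers: two vertices reached from [v] by [h] edges of colour [j], going up or
    down at the same steps, have equally many edges on each side once the equation is written
    without subtraction. *)
Definition balanced j h Y := forall y y', y \in Y -> y' \in Y ->
  exists s t : seq nat, [/\ size s = h, size t = h, all (colored j) s,
    all (colored j) t & (y + sumn s = y' + sumn t)%N].

Lemma balanced1 j (v : 'I_N.+1) : balanced j 0 [set v].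
Proof. by move=> y y' /set1P-> /set1P->; exists [::], [::]. Qed.

Lemma balanced_upper j h V Y : balanced j h Y -> balanced j h.+1 (upper j V Y).
Proof.
move=> bY w w' /upperP[_ [y yY [a ca ->]]] /upperP[_ [y' y'Y [a' ca' ->]]].
have [s [t [ss st cs ct E]]] := bY y y' yY y'Y.
exists (a' :: s), (a :: t); rewrite /= ss st ca ca'; split=> //.
by rewrite [(a' + _)%N]addnC [(a + sumn _)%N]addnC addnACA E [RHS]addnACA [(a' + a)%N]addnC.
Qed.

Lemma balanced_lower j h V Y : balanced j h Y -> balanced j h.+1 (lower j V Y).
Proof.
move=> bY w w' /lowerP[_ [y yY [a ca E1]]] /lowerP[_ [y' y'Y [a' ca' E2]]].
have [s [t [ss st cs ct E]]] := bY y y' yY y'Y.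
exists (a :: s), (a' :: t); rewrite /= ss st ca ca'; split=> //.
by rewrite !addnA -E1 -E2.
Qed.

(** Every length [h <= m] is excluded, not only [m], since the layers of all depths up to [m] must
    be free of edges of colour [j]. *)
Hypothesis chi_free : forall j h a (s t : seq nat), (h <= m)%N ->
  size s = h -> size t = h -> colored j a -> all (colored j) s ->
  all (colored j) t -> sumn s <> (a + sumn t)%N.

(** An edge [w = y + a] inside [Y], put into the balance equation of [y] and [w], leaves
    [sumn s = a + sumn t] after cancelling [y]. *)
Lemma balanced_disjoint j h V Y :
  (h <= m)%N -> balanced j h Y -> [disjoint Y & nbr j V Y].
Proof.
move=> hm bY; rewrite disjoint_subset; apply/subsetP => w wY.
rewrite inE /=; apply/negP => /setUP[/upperP|/lowerP] [_ [y yY [a ca E]]].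
  have [s [t [ss st cs ct]]] := bY y w yY wY.
  by rewrite E -addnA => /addnI; apply: chi_free hm ss st ca cs ct.
have [s [t [ss st cs ct]]] := bY w y wY yY.
by rewrite E -addnA => /addnI; apply: chi_free hm ss st ca cs ct.
Qed.

(** * Growing layers until a light neighbourhood appears *)

Section Weights.
Variables (R : realFieldType) (omega : 'I_N.+1 -> R).
Hypothesis omega_gt0 : forall v, 0 < omega v.

Local Notation wt Y := (\sum_(y in Y) omega y).

Lemma weight_ge0 Y : 0 <= wt Y.
Proof. by apply: sumr_ge0 => y _; apply: ltW. Qed.

Lemma weight_gt0_neq0 Y : 0 < wt Y -> Y != set0.
Proof. by apply: contraTneq => ->; rewrite big_set0 ltxx. Qed.

Lemma weight_disjointU Y Y' : [disjoint Y & Y'] -> wt (Y :|: Y') = wt Y + wt Y'.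
Proof.
move=> dYY'; rewrite (big_setID Y) /= (setIidPr (subsetUl _ _)) setDUl setDv.
by rewrite set0U (setDidPl _) // disjoint_sym.
Qed.

Lemma weight_subset Y Y' : Y \subset Y' -> wt Y <= wt Y'.
Proof.
move=> sYY'; rewrite [leRHS](big_setID Y) /= (setIidPr sYY') lerDl.
exact: weight_ge0.
Qed.

Lemma weightU_le Y Y' : wt (Y :|: Y') <= wt Y + wt Y'.
Proof.
rewrite (big_setID Y) /= (setIidPr (subsetUl _ _)) setDUl setDv set0U lerD2l.
exact/weight_subset/subsetDl.
Qed.

Lemma heavier_side j V Y : exists2 Y' : {set 'I_N.+1}, wt (nbr j V Y) <= 2 * wt Y' &
  Y' = upper j V Y \/ Y' = lower j V Y.
Proof.
have := weightU_le (upper j V Y) (lower j V Y); rewrite -/(nbr j V Y) => H.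
have [le|/ltW le] := leP (wt (lower j V Y)) (wt (upper j V Y)).
  by exists (upper j V Y); [lra | left].
by exists (lower j V Y); [lra | right].
Qed.

(** [K] stands for [k^(1/m)], and [U] for the vertices whose list still contains [j]. Keeping [Y]
    inside [U] ensures that [j] can really be removed from the lists on [Y]. *)
Lemma light_neighborhood V v j (k K : R) (U : {set 'I_N.+1}) :
  (0 < m)%N -> v \in V -> 0 < K -> K ^+ m = k ->
  wt V - omega v <= k * wt (nbr j V [set v]) ->
  v \in U -> (forall Y, Y \subset V -> nbr j V Y \subset U) ->
  exists Y, [/\ Y \subset V :&: U, Y != set0, [disjoint Y & nbr j V Y] &
    wt (nbr j V Y) <= 2 * K * wt Y].
Proof.
move=> m0 vV K0 Kk Hv vU HU.
pose layer h Y := [/\ Y \subset V :&: U, Y != set0 & balanced j h Y].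
have [[h hm [Y [[sY Y0 bY] le]]]|no] := boolp.EM (exists2 h, (h <= m)%N &
    exists Y, layer h Y /\ wt (nbr j V Y) <= 2 * K * wt Y).
  by exists Y; split=> //; exact: balanced_disjoint hm bY.
exfalso.
have heavy h Y : (h <= m)%N -> layer h Y -> 2 * K * wt Y < wt (nbr j V Y).
  by move=> hm lY; rewrite ltNge; apply/negP => le; case: no; exists h => //; exists Y.
have next h Y : (h <= m)%N -> layer h Y ->
    exists2 Y', layer h.+1 Y' & wt (nbr j V Y) <= 2 * wt Y'.
  move=> hm lY; have [Y' le eY'] := heavier_side j V Y.
  exists Y' => //; have hY := heavy h Y hm lY; case: lY => sY Y0 bY.
  have sN : nbr j V Y \subset V :&: U.
    by rewrite subsetI nbr_sub HU // (subset_trans sY) ?subsetIl.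
  have Y'0 : Y' != set0.
    apply: weight_gt0_neq0; have := mulr_ge0 (ltW K0) (weight_ge0 Y); lra.
  split=> //; case: eY' => ->.
  - by apply: subset_trans sN; apply: subsetUl.
  - by apply: subset_trans sN; apply: subsetUr.
  - exact: balanced_upper.
  - exact: balanced_lower.
have lv : layer 0 [set v].
  split; [by rewrite sub1set inE vV vU | | exact: balanced1].
  by apply/set0Pn; exists v; rewrite inE.
set D := wt (nbr j V [set v]) in Hv.
(* The first step keeps at least half of [D]. Each later step gains a factor [2 * K] and loses at
   most 2 in choosing a side. *)
have grow h : (h < m)%N -> exists2 Y, layer h.+1 Y & K ^+ h * D <= 2 * wt Y.
  elim: h => [|h IH] hm.
    have [Y lY le] := next _ _ (leq0n m) lv.
    by exists Y => //; rewrite expr0 mul1r.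
  have [Y lY le] := IH (ltnW hm).
  have [Y' lY' le'] := next _ _ (ltnW hm) lY.
  exists Y' => //; apply: le_trans le'; apply: le_trans (ltW (heavy _ _ (ltnW hm) lY)).
  by rewrite exprS -mulrA [2 * K]mulrC -mulrA ler_pM2l.
(* The last layer is compared with its whole neighbourhood, upper and lower;
   this compensates the factor 2 lost in choosing a side at the first step. *)
have [Y lY le] := grow m.-1 ltac:(by rewrite prednK).
rewrite prednK // in lY; have hY := heavy _ _ (leqnn m) lY.
have hv := heavy _ _ (leq0n m) lv; rewrite big_set1 -/D in hv.
case: (lY) => sY Y0 bY.
have dY := balanced_disjoint V (leqnn m) bY.
have tot : wt Y + wt (nbr j V Y) <= wt V.
  rewrite -weight_disjointU //; apply: weight_subset.
  by rewrite subUset nbr_sub (subset_trans sY) ?subsetIl.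
have Dtot : omega v + D <= wt V.
  rewrite -(big_set1 +%R v omega) -weight_disjointU; last first.
    exact: balanced_disjoint (leq0n m) (@balanced1 j v).
  by apply: weight_subset; rewrite subUset nbr_sub sub1set vV.
have kD : k * D <= 2 * K * wt Y.
  rewrite -Kk -(prednK m0) exprS -mulrA [2 * K]mulrC -mulrA.
  by rewrite ler_pM2l.
(* The last layer forces [wt V < (1 + 2 * K) * omega v], while [hv] and [Dtot] give the reverse
   strict inequality. *)
have : (1 + 2 * K) * (wt V - omega v) <= 2 * K * ((1 + 2 * K) * wt Y).
  rewrite mulrCA ler_pM2l; lra.
have : 2 * K * ((1 + 2 * K) * wt Y) < 2 * K * wt V by rewrite ltr_pM2l; lra.
move: hv Dtot; lra.
Qed.

End Weights.

(** * The weight bound, by shrinking the colour lists *)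

Lemma diff_colorC u w : diff_color u w = diff_color w u.
Proof. by rewrite /diff_color addnC. Qed.

(** Averaging: the [j]-neighbourhoods of [v], for [j] in [T], partition [V] without [v]. *)
Lemma heavy_color (R : realFieldType) (omega : 'I_N.+1 -> R) V v (T : {set C}) :
  v \in V -> T != set0 ->
  (forall w, w \in V -> v != w -> diff_color v w \in T) ->
  exists2 j, j \in T & \sum_(w in V) omega w - omega v
                       <= #|T|%:R * \sum_(w in nbr j V [set v]) omega w.
Proof.
move=> vV T0 HT.
set D := _ - _.
have ED : D = \sum_(j in T) \sum_(w in nbr j V [set v]) omega w.
  rewrite /D (bigD1 v vV) /= addrAC subrr add0r.
  rewrite (partition_big (fun w : 'I_N.+1 => diff_color w v) (mem T)) /=; last first.
    by move=> w /andP[wV wv]; rewrite diff_colorC HT // eq_sym.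
  apply: eq_bigr => j _; apply: eq_bigl => w; apply/idP/nbrP.
    case/andP=> /andP[wV wv] cj; split=> //; exists v; first exact: set11.
    by rewrite eq_sym wv.
  by case=> wV [y /set1P-> /andP[vw ->]]; rewrite andbT eq_sym vw andbT.
have [/exists_inP[j jT le]|/exists_inPn no] := boolP [exists j in T,
    D <= #|T|%:R * \sum_(w in nbr j V [set v]) omega w]; first by exists j.
have: \sum_(j in T) (#|T|%:R * \sum_(w in nbr j V [set v]) omega w)
      < \sum_(j in T) D.
  apply: ltr_sum => [|j jT]; last by rewrite ltNge no.
  by have /set0Pn[j jT] := T0; apply/hasP; exists j; rewrite ?mem_index_enum.
by rewrite -mulr_sumr -ED sumr_const mulr_natl ltxx.
Qed.

Lemma weight_le1 (R : realType) (T : 'I_N.+1 -> {set C}) V :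
  (0 < m)%N ->
  (forall u w, u \in V -> w \in V -> u != w -> diff_color u w \in T u) ->
  \sum_(v in V) (bound_prod R m #|T v|)^-1 <= 1.
Proof.
move=> m0; have [n] := ubnP (\sum_(v in V) #|T v|).
elim: n T V => // n IH T V /ltnSE len HT.
pose omega v : R := (bound_prod R m #|T v|)^-1.
have omega0 v : 0 < omega v by rewrite invr_gt0 bound_prod_gt0.
have [/exists_inP[v0 v0V Tv0]|/exists_inPn none] :=
    boolP [exists v in V, T v != set0]; last first.
  (* All lists are empty, so two distinct vertices would have an edge with no possible colour; a
     single vertex weighs 1. *)
  have [V1|] := leqP #|V| 1.
    apply: le_trans (_ : #|V|%:R <= 1); last by rewrite lern1.
    rewrite -sumr_const ler_sum // => v vV.
    by rewrite (eqP (negbNE (none v vV))) cards0 /bound_prod big_geq ?invr1.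
  case/card_gt1P=> u [w [uV wV uw]]; have := HT u w uV wV uw.
  by rewrite (eqP (negbNE (none u uV))) inE.
pose P v := (v \in V) && (T v != set0).
have [v /andP[vV Tv] vmin] := @arg_minnP _ v0 P (fun v => #|T v|) (introT andP (conj v0V Tv0)).
have [j jTv le] := heavy_color omega vV Tv (fun w wV => HT v w vV wV).
pose K : R := #|T v|%:R `^ (m%:R)^-1.
have k0 : (0 < #|T v|)%N by rewrite card_gt0.
have K0 : 0 < K by rewrite powR_gt0 // ltr0n.
have Km : K ^+ m = #|T v|%:R.
  rewrite /K -powR_mulrn ?powR_ge0 // -powRrM mulVf ?powRr1 ?ler0n //.
  by rewrite pnatr_eq0 -lt0n.
have HU (Y : {set 'I_N.+1}) : Y \subset V -> nbr j V Y \subset [set u | j \in T u].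
  move=> sY; apply/subsetP => w /nbrP[wV [y yY /andP[yw /eqP <-]]].
  by rewrite inE (HT w y wV (subsetP sY y yY)) // eq_sym.
have vU : v \in [set u | j \in T u] by rewrite inE.
have [Y [sY Y0 dY leY]] := light_neighborhood omega0 m0 vV K0 Km le vU HU.
have sYV : Y \subset V by rewrite (subset_trans sY) ?subsetIl.
have jY y : y \in Y -> j \in T y by move=> /(subsetP sY); rewrite !inE => /andP[].
pose V' := V :\: nbr j V Y.
(* The new lists stay valid because no vertex of [V'] is joined to [Y] in colour [j]; [Y] itself
   survives in [V'] by [dY]. *)
pose T' u := if u \in Y then T u :\ j else T u.
have sYV' : Y \subset V' by rewrite subsetD sYV.
have HT' u w : u \in V' -> w \in V' -> u != w -> diff_color u w \in T' u.
  move=> /setDP[uV _] /setDP[wV wN] uw; rewrite /T'.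
  case: ifP => uY; last exact: HT.
  rewrite in_setD1 HT // andbT; apply: contraNneq wN => cj.
  by apply/nbrP; split=> //; exists u; rewrite // uw diff_colorC cj eqxx.
(* The total list size drops strictly: [Y] is nonempty and each of its vertices loses [j]. *)
have lt : (\sum_(u in V') #|T' u| < n)%N.
  apply: leq_trans len; rewrite [X in (_ < X)%N](big_setID V') /=.
  rewrite (setIidPr (subsetDl _ _)); apply: leq_trans (leq_addr _ _).
  have [y yY] := set0Pn _ Y0; have yV' := subsetP sYV' y yY.
  rewrite (bigD1 y yV') [X in (_ < X)%N](bigD1 y yV') /= -addSn leq_add //.
    by rewrite /T' yY [X in (_ <= X)%N](cardsD1 j) jY.
  by apply: leq_sum => u _; rewrite /T'; case: ifP => // _; rewrite subset_leq_card ?subsetDl.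
apply: le_trans (IH T' V' lt HT').
rewrite -/(omega _).
have EV : \sum_(u in V) omega u = \sum_(u in Y) omega u
    + \sum_(u in V' :\: Y) omega u + \sum_(u in nbr j V Y) omega u.
  rewrite (big_setID (nbr j V Y)) /= (setIidPr (nbr_sub j V Y)) -/V' addrC.
  by rewrite (big_setID Y) /= (setIidPr sYV').
have EV' : \sum_(u in V') (bound_prod R m #|T' u|)^-1 =
    \sum_(u in Y) (bound_prod R m #|T u :\ j|)^-1 + \sum_(u in V' :\: Y) omega u.
  rewrite (big_setID Y) /= (setIidPr sYV'); congr (_ + _).
    by apply: eq_bigr => u uY; rewrite /T' uY.
  by apply: eq_bigr => u /setDP[_ /negbTE uY]; rewrite /T' uY.
have gain : (1 + 2 * K) * (\sum_(u in Y) omega u)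
    <= \sum_(u in Y) (bound_prod R m #|T u :\ j|)^-1.
  rewrite mulr_sumr; apply: ler_sum => u uY.
  have uP : P u by rewrite /P (subsetP sYV) //; apply/set0Pn; exists j; apply: jY.
  have le_vu := vmin u uP; rewrite /omega.
  have Eu : #|T u| = #|T u :\ j|.+1 by rewrite (cardsD1 j) jY.
  rewrite {1}Eu bound_prodS invfM mulrCA.
  apply: ler_piMr; first by rewrite invr_ge0 ltW ?bound_prod_gt0.
  have L0 : 0 <= (#|T u :\ j|.+1%:R : R) `^ m%:R^-1 by apply: powR_ge0.
  rewrite ler_pdivrMr ?mul1r; last by lra.
  have : K <= (#|T u :\ j|.+1%:R : R) `^ m%:R^-1; last by lra.
  by rewrite /K ge0_ler_powR ?invr_ge0 ?nnegrE ?ler0n // ler_nat -Eu.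
(* By [leY], the deleted weight is at most the surplus [2 * K] times the weight of [Y] provided by
   [gain]. *)
rewrite EV EV'; lra.
Qed.

End DifferenceGraph.

(** * From the weight bound to the theorem *)

Theorem theorem1 (R : realType) (r m N : nat)
    (hr : (0 < r)%N) (hm : (0 < m)%N) (hN : (0 < N)%N)
    (hbound : \prod_(1 <= k < r.+1) (1 + 2 * (k%:R : R) `^ (m%:R)^-1) <= N%:R)
    (phi : nat -> nat) (hphi : is_coloring N r phi) :
  has_monochromatic_solution m N phi.
Proof.
apply: boolp.contrapT => nosol.
case: r hr hbound hphi => // r _ hbound hphi.
(* Colours start at 1 and ordinals at 0. Outside [1..N] the value is arbitrary, which is why
   [colored] includes the range. *)
pose chi a : 'I_r.+1 := inord (phi a).-1.
have chi_phi a b : (0 < a <= N)%N -> (0 < b <= N)%N -> chi a = chi b -> phi a = phi b.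
  move=> /hphi/andP[a0 ar] /hphi/andP[b0 br] /(congr1 val).
  rewrite /= !inordK ?prednK // => E.
  by rewrite -(prednK a0) -(prednK b0) E.
have chi_free j h a (s t : seq nat) : (h <= m)%N ->
    size s = h -> size t = h -> colored N chi j a -> all (colored N chi j) s ->
    all (colored N chi j) t -> sumn s <> (a + sumn t)%N.
  move=> hm' ss st ca cs ct E; apply: nosol.
  (* Adding [a] to both sides pads the equation to the required length. *)
  pose p := nseq (m - h) a.
  have cp : all (colored N chi j) p by rewrite all_nseq ca orbT.
  have mono (q : seq nat) i : all (colored N chi j) q -> (i < size q)%N ->
      (1 <= nth 0 q i <= N)%N /\ phi (nth 0 q i) = phi a.
    move=> /(all_nthP 0) cq iq; case/andP: (cq i iq) => bi /eqP ci.
    by case/andP: ca => ba /eqP ca; split=> //; apply: chi_phi; rewrite // ca.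
  have sx : size (a :: t ++ p) = m.+1 by rewrite /= size_cat size_nseq st subnKC.
  have sy : size (s ++ p) = m by rewrite size_cat size_nseq ss subnKC.
  exists (fun i => nth 0 (a :: t ++ p) i)%N, (fun i => nth 0 (s ++ p) i)%N, (phi a).
  split=> [i|i|].
  - by apply: mono; rewrite ?sx //= ca all_cat ct.
  - by apply: mono; rewrite ?sy // all_cat cs.
  have sum_nth (q : seq nat) k : size q = k -> (\sum_(i < k) nth 0 q i)%N = sumn q.
    by move=> <-; rewrite sumnE (big_nth 0%N) big_mkord.
  by rewrite /is_solution !sum_nth //= !sumn_cat E addnA.
(* All [N + 1] vertices with full lists: the product would be at least [N + 1], against [hbound]. *)
have := @weight_le1 N m 'I_r.+1 chi chi_free R (fun=> setT) setT hm.
rewrite sumr_const !cardsT !card_ord => /(_ (fun _ _ _ _ _ => in_setT _)).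
rewrite -mulr_natl ler_pdivrMr ?bound_prod_gt0 // mul1r => le.
by have := le_trans le hbound; rewrite ler_nat ltnn.
Qed.
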